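(* Let $t>0$. Let $\Omega_t=D([0,t),\mathbb R^d)$ be endowed with the uniform Skorokhod topology on compact spaces and $\Omega=D([0,\infty),\mathbb R^d)$ with the Skorokhod topology. The projection $$\Pi_t:D([0,\infty),\mathbb R^d)\to D([0,t),\mathbb R^d),\qquad x\mapsto x_{|[0,t)}$$ is continuous.
   Context: $D(I,\mathbb R^d)$ is the set of càdlàg functions $I\to\mathbb R^d$ (right continuous with left limits at every point of $I$). The Skorokhod topology on $D([0,\infty),\mathbb R^d)$ is the usual ($J_1$) topology as in Billingsley, metrized by a metric $d_\infty$: $x_n\to x$ iff there are strictly increasing continuous bijections $\lambda_n$ of $[0,\infty)$ with $\sup_{u\ge0}|\lambda_n(u)-u|\to0$ and $\sup_{u\in[0,k]}\|x_n(\lambda_n(u))-x(u)\|\to0$ for every $k\in\mathbb N$. The uniform Skorokhod topology on compact spaces on $D([0,t),\mathbb R^d)$ is the topology deduced from it via the homeomorphism $\alpha_t:[0,t)\to[0,\infty)$, $\alpha_t(u)=\frac{u}{t-u}$; it is defined by the metric $\hat d(x,y)=d_\infty(x\circ\alpha_t^{-1},y\circ\alpha_t^{-1})$. *)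

(* Defs.v *)
From HB Require Import structures.
From mathcomp Require Import all_boot all_order all_algebra.
From mathcomp Require Import all_classical all_reals all_analysis.
From mathcomp Require Import ring lra.
Set Implicit Arguments.
Unset Strict Implicit.
Unset Printing Implicit Defensive.
Import Order.TTheory GRing.Theory Num.Theory.
Import numFieldNormedType.Exports.
Local Open Scope classical_set_scope.
Local Open Scope ring_scope.

(* Points of an interval I are elements of the subtype set_type I, which
   carries the subspace topology. At a point with no y < x in I (a closed left
   end) the filter of the second conjunct is trivial, so that the existence of
   a left limit is vacuous there. *)
Definition is_cadlag (R : realType) (d : nat) (I : set R)
    (f : I -> 'rV[R]_d) : Prop :=
  forall x : I,
    f y @[y --> within [set y : I | set_val x <= set_val y] (nbhs x)] --> f x /\
    exists l : 'rV[R]_d,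
      f y @[y --> within [set y : I | set_val y < set_val x] (nbhs x)] --> l.

Record cadlag (R : realType) (d : nat) (I : set R) : Type := Cadlag {
  cadlag_fun :> I -> 'rV[R]_d;
  cadlagP : is_cadlag cadlag_fun }.

HB.instance Definition _ (R : realType) d (I : set R) :=
  gen_eqMixin (cadlag d I).
HB.instance Definition _ (R : realType) d (I : set R) :=
  gen_choiceMixin (cadlag d I).

Lemma cadlag_eq (R : realType) d (I : set R) (x y : cadlag d I) :
  x =1 y -> x = y.
Proof.
case: x y => [f Pf] [g Pg] /= /funext fg.
by subst g; congr Cadlag; exact: Prop_irrelevance.
Qed.

Definition halfline (R : realType) : set R := `[0, +oo[%classic.
Arguments halfline : clear implicits.

Definition cooint (R : realType) (t : R) : set R := `[0, t[%classic.

Lemma halfline_ge0 (R : realType) (u : halfline R) : 0 <= set_val u.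
Proof. by have := set_valP u; rewrite /halfline /= in_itv /= andbT. Qed.

Lemma cooint_ge0 (R : realType) (t : R) (u : cooint t) : 0 <= set_val u.
Proof. by have := set_valP u; rewrite /cooint /= in_itv /= => /andP[]. Qed.

Lemma cooint_lt (R : realType) (t : R) (u : cooint t) : set_val u < t.
Proof. by have := set_valP u; rewrite /cooint /= in_itv /= => /andP[]. Qed.

Lemma mem_halfline (R : realType) (u : R) : 0 <= u -> u \in halfline R.
Proof. by move=> u0; apply/mem_set; rewrite /halfline /= in_itv /= andbT. Qed.

Lemma mem_cooint (R : realType) (t u : R) : 0 <= u -> u < t -> u \in cooint t.
Proof.
by move=> u0 ut; apply/mem_set; rewrite /cooint /= in_itv /= u0.
Qed.

Definition to_halfline (R : realType) (u : R) (u0 : 0 <= u) : halfline R :=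
  exist _ u (mem_halfline u0).

Definition to_cooint (R : realType) (t u : R) (u0 : 0 <= u) (ut : u < t) :
    cooint t :=
  exist _ u (mem_cooint u0 ut).

Lemma to_halflineE (R : realType) (u : R) (u0 : 0 <= u) :
  set_val (to_halfline u0) = u.
Proof. by []. Qed.

Lemma to_coointE (R : realType) (t u : R) (u0 : 0 <= u) (ut : u < t) :
  set_val (to_cooint u0 ut) = u.
Proof. by []. Qed.

Lemma set_val_inj (T : Type) (A : set T) : injective (@set_val T A).
Proof. exact: val_inj. Qed.

Section subtype_limits.
Context {R : realType}.
Implicit Types I J : set R.

Lemma val_continuous I : continuous (fun y : I => set_val y : R).
Proof. exact: (@initial_continuous I R set_val). Qed.

Lemma continuous_set_type (T : topologicalType) J (f : T -> J) :
  continuous (fun y => set_val (f y) : R) -> continuous f.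
Proof. by move=> cf; exact/(@continuous_comp_initial J T R set_val f). Qed.

Lemma nbhs_set_typeP I (x : I) (U : set I) :
  nbhs x U <-> exists2 e : R, 0 < e &
    forall y : I, `|set_val y - set_val x| < e -> U y.
Proof.
split.
  case=> V [[W oW <-] /= Wx] VU.
  have /nbhs_ballP[e /= e0 eW] : nbhs (set_val x) W by exact: open_nbhs_nbhs.
  exists e => // y yx; apply: VU => /=; apply: eW.
  by rewrite /ball /= distrC; exact: yx.
move=> [e e0 eU].
have /filterS : (set_val @^-1` ball (set_val x : R) e) `<=` U.
  by move=> y /= xy; apply: eU; rewrite distrC.
apply; apply: (@val_continuous I x); exact: nbhsx_ballx.
Qed.

Lemma is_cadlag_comp d I J (f : I -> 'rV[R]_d) (phi : J -> I) :
  continuous phi -> {homo phi : u v / set_val u < set_val v} ->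
  is_cadlag f -> is_cadlag (f \o phi).
Proof.
move=> cphi mphi cf x.
have cwithin (P : set I) (Q : set J) : (forall y, Q y -> P (phi y)) ->
    phi @ within Q (nbhs x) --> within P (nbhs (phi x)).
  move=> QP A PA.
  have : \forall y \near x, P (phi y) -> A (phi y) := cphi x _ PA.
  by apply: (@filterS _ (nbhs x)) => y /= yA Qy; apply: yA; exact: QP.
have [cr [l cl]] := cf (phi x); split.
  move=> A /cr; apply: (cwithin [set y | set_val (phi x) <= set_val y]) => y /=.
  by rewrite le_eqVlt => /orP[/eqP/set_val_inj -> //|/mphi/ltW].
exists l => A /cl.
apply: (cwithin [set y | set_val y < set_val (phi x)]) => y /=.
exact: mphi.
Qed.

End subtype_limits.

Definition is_time_change (R : realType) (lam : halfline R -> halfline R) :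
    Prop :=
  [/\ continuous lam, {homo lam : u v / set_val u < set_val v} & bijective lam].

Section time_changes.
Context {R : realType}.
Implicit Types lam mu : halfline R -> halfline R.

Lemma is_time_change_id : is_time_change (@id (halfline R)).
Proof. by split => //; [move=> x; exact: cvg_id | exists id]. Qed.

Lemma is_time_change_comp lam mu :
  is_time_change lam -> is_time_change mu -> is_time_change (mu \o lam).
Proof.
move=> [cl ml bl] [cm mm bm]; split.
- by move=> x; apply: continuous_comp; [exact: cl | exact: cm].
- by move=> u v /= /ml /mm.
- exact: bij_comp.
Qed.

Lemma incr_can_continuous lam mu :
  {homo lam : u v / set_val u < set_val v} -> cancel mu lam -> continuous lam.
Proof.
move=> ml muK.
have lam_lt u v : set_val (lam u) < set_val (lam v) -> set_val u < set_val v.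
  move=> uv; rewrite ltNge; apply/negP; rewrite le_eqVlt.
  move=> /orP[/eqP/set_val_inj vu|/ml vu]; first by rewrite vu ltxx in uv.
  by have := lt_trans uv vu; rewrite ltxx.
apply: continuous_set_type => x.
have Fx : Filter (nbhs x) := nbhs_filter x.
apply/cvgrPdist_lt => e e0.
have xe0 : 0 <= set_val (lam x) + e by have := halfline_ge0 (lam x); lra.
have [b xb bE] : exists2 b, set_val x < set_val b &
    set_val (lam b) = set_val (lam x) + e.
  exists (mu (to_halfline xe0)); last by rewrite muK to_halflineE.
  by apply: lam_lt; rewrite muK to_halflineE; lra.
have near_b : \forall y \near x, set_val (lam y) < set_val (lam x) + e.
  apply/nbhs_set_typeP; exists (set_val b - set_val x).
    by rewrite subr_gt0.
  by move=> y xy; rewrite -bE; apply: ml; move: xy; rewrite ltr_norml; lra.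
have near_a : \forall y \near x, set_val (lam x) - e < set_val (lam y).
  have [ae0|] := leP 0 (set_val (lam x) - e); last first.
    move=> ae0; apply/nbhs_set_typeP; exists 1 => // y _.
    exact: lt_le_trans ae0 (halfline_ge0 _).
  pose a := mu (to_halfline ae0).
  have aE : set_val (lam a) = set_val (lam x) - e by rewrite muK to_halflineE.
  have ax : set_val a < set_val x by apply: lam_lt; rewrite aE; lra.
  apply/nbhs_set_typeP; exists (set_val x - set_val a).
    by rewrite subr_gt0.
  by move=> y xy; rewrite -aE; apply: ml; move: xy; rewrite ltr_norml; lra.
apply: (@filterS _ (nbhs x)) (filterI near_b near_a) => y [h1 h2].
rewrite ltr_norml; apply/andP; split; lra.
Qed.

Lemma is_time_change_inv lam : is_time_change lam ->
  exists mu, [/\ is_time_change mu, cancel lam mu & cancel mu lam].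
Proof.
move=> [cl ml [mu lamK muK]]; exists mu; split => //.
have mm : {homo mu : u v / set_val u < set_val v}.
  move=> u v uv; rewrite ltNge; apply/negP; rewrite le_eqVlt.
  move=> /orP[/eqP/set_val_inj/(can_inj muK) vu|/ml].
    by rewrite vu ltxx in uv.
  by rewrite !muK => /(lt_trans uv); rewrite ltxx.
split => //; first exact: incr_can_continuous mm lamK.
by exists lam.
Qed.

End time_changes.

Definition skorokhod (R : realType) (d : nat) : Type := cadlag d (halfline R).
HB.instance Definition _ R d := Choice.on (skorokhod R d).

Definition skorokhod_close (R : realType) d (k e : R)
    (lam : halfline R -> halfline R) (x y : skorokhod R d) : Prop :=
  [/\ is_time_change lam,
      forall u, `|set_val (lam u) - set_val u| < e &
      forall u, set_val u <= k -> `|y (lam u) - x u| < e].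

(* The J1 topology is given as a uniform topology: its basic entourages are the
   sets of pairs (x, y) for which one time change is within e of the identity
   and makes y \o lam and x e-close on [0, k]. The lemmas skorokhod_cvgP,
   skorokhod_countable_uniformity and skorokhod_hausdorff show that it is
   metrizable with the J1 convergent sequences, which determines it. *)
Section skorokhod_uniform.
Context (R : realType) (d : nat).
Local Notation S := (skorokhod R d).

Let base (q : R * R) : set (S * S) :=
  [set p | exists lam, skorokhod_close q.1 q.2 lam p.1 p.2].

Definition skorokhod_entourage : set_system (S * S) :=
  filter_from [set q : R * R | 0 < q.2] base.

Let base_sub k e k' e' : k' <= k -> e <= e' -> base (k, e) `<=` base (k', e').
Proof.
move=> kk ee [x y] [lam /= [tl le xe]]; exists lam; split => //= u.
  exact: lt_le_trans (le u) ee.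
by move=> uk; apply: lt_le_trans (xe _ _) ee; exact: le_trans uk kk.
Qed.

Let ent_filter : Filter skorokhod_entourage.
Proof.
apply: filter_from_filter; first by exists (0, 1) => /=.
move=> [k e] [k' e'] /= e0 e0'; exists (Num.max k k', Num.min e e').
  by rewrite /= lt_min e0.
move=> p bp; split; apply: base_sub bp;
  by rewrite ?le_max ?ge_min lexx ?orbT.
Qed.

Let ent_diag A : skorokhod_entourage A -> diagonal `<=` A.
Proof.
move=> [[k e] /= e0 bA] [x y] /diagonalP ->; apply: bA; exists id; split => /=.
- exact: is_time_change_id.
- by move=> u; rewrite subrr normr0.
- by move=> u _; rewrite subrr normr0.
Qed.

Let ent_inv A : skorokhod_entourage A -> skorokhod_entourage A^-1%relation.
Proof.
move=> [[k e] /= e0 bA]; exists (k + 1, Num.min e 1).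
  by rewrite /= lt_min e0 ltr01.
move=> [x y] [lam /= [tl lam_e xy_e]]; apply: bA => /=.
have [mu [tm lamK muK]] := is_time_change_inv tl.
exists mu; split => //= u => [|uk].
  have := lam_e (mu u); rewrite muK distrC => /lt_le_trans; apply.
  by rewrite ge_min lexx.
have := xy_e (mu u); rewrite muK distrC => /(_ _)/lt_le_trans; apply.
  have := lam_e (mu u); rewrite muK lt_min => /andP[_].
  by rewrite ltr_norml => /andP[lo _]; lra.
by rewrite ge_min lexx.
Qed.

Let ent_split A : skorokhod_entourage A ->
  exists2 B, skorokhod_entourage B & (B \; B)%relation `<=` A.
Proof.
move=> [[k e] /= e0 bA].
pose e' := Num.min (e / 2) 1.
have e'0 : 0 < e' by rewrite lt_min ltr01 divr_gt0.
have e'e : e' <= e / 2 by rewrite ge_min lexx.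
have e'1 : e' <= 1 by rewrite ge_min lexx orbT.
clearbody e'.
exists (base (k + 1, e')); first by exists (k + 1, e').
move=> [x z] [y /= [lam /= [tl lam_e xy_e]] [mu /= [tm mu_e yz_e]]].
apply: bA; exists (mu \o lam); split => /= [|u|u uk].
- exact: is_time_change_comp.
- have := lam_e u; have := mu_e (lam u).
  rewrite !ltr_norml => /andP[? ?] /andP[? ?]; apply/andP; split; lra.
- rewrite -(subrKA (y (lam u))) (splitr e).
  apply: le_lt_trans (ler_normD _ _) _; apply: ltrD.
    apply: lt_le_trans (yz_e _ _) e'e.
    by have := lam_e u; rewrite ltr_norml; lra.
  by apply: lt_le_trans (xy_e _ _) e'e; lra.
Qed.

HB.instance Definition _ := @isUniform.Build S skorokhod_entourage
  ent_filter ent_diag ent_inv ent_split.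

Lemma nbhs_skorokhodP (x : S) (U : set S) :
  nbhs x U <-> exists m : nat, forall y,
    (exists lam, skorokhod_close m%:R m.+1%:R^-1 lam x y) -> U y.
Proof.
rewrite -nbhs_entourageE; split.
  move=> [A [[k e] /= e0 bA] AU].
  have [m [km em]] : exists m : nat, k <= m%:R /\ m.+1%:R^-1 <= e.
    exists (maxn (Num.truncn k).+1 (Num.truncn e^-1)); split.
      by apply: le_trans (ltW (truncnS_gt k)) _; rewrite ler_nat leq_maxl.
    rewrite invf_ple ?posrE//; apply: le_trans (ltW (truncnS_gt _)) _.
    by rewrite ler_nat ltnS leq_maxr.
  exists m => y xy; apply: AU; apply/mem_set; apply: bA.
  exact: (base_sub km em).
move=> [m mU]; exists (base (m%:R, m.+1%:R^-1)).
  by exists (m%:R, m.+1%:R^-1) => //=.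
by move=> y /set_mem xy; exact: mU.
Qed.

Lemma skorokhod_countable_uniformity : countable_uniformity S.
Proof.
apply/countable_uniformityP.
exists (fun m => base (m%:R, m.+1%:R^-1)); last first.
  by move=> m; exists (m%:R, m.+1%:R^-1) => /=.
move=> A [[k e] /= e0 bA].
exists (maxn (Num.truncn k).+1 (Num.truncn e^-1)).
apply: subset_trans bA; apply: base_sub.
  by apply: le_trans (ltW (truncnS_gt k)) _; rewrite ler_nat leq_maxl.
rewrite invf_ple ?posrE//; apply: le_trans (ltW (truncnS_gt _)) _.
by rewrite ler_nat ltnS leq_maxr.
Qed.

End skorokhod_uniform.

Lemma skorokhod_cvgP (R : realType) d (x_ : nat -> skorokhod R d)
    (x : skorokhod R d) :
  x_ n @[n --> \oo] --> x <->
  exists lam_ : nat -> halfline R -> halfline R,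
    [/\ forall n, is_time_change (lam_ n),
        forall e, 0 < e -> \forall n \near \oo,
          forall u, `|set_val (lam_ n u) - set_val u| < e &
        forall (k : nat) e, 0 < e -> \forall n \near \oo,
          forall u, set_val u <= k%:R -> `|x_ n (lam_ n u) - x u| < e].
Proof.
split=> [xx|[lam_ [tl lam_e xe]]].
  have closeW (m m' : nat) lam y : (m' <= m)%N ->
      skorokhod_close m%:R m.+1%:R^-1 lam x y ->
      skorokhod_close m'%:R m'.+1%:R^-1 lam x y.
    move=> m'm [tl le xe].
    have mm : m.+1%:R^-1 <= m'.+1%:R^-1 :> R.
      by rewrite lef_pV2 ?posrE// ler_nat.
    split=> // u => [|um']; first exact: lt_le_trans (le u) mm.
    apply: lt_le_trans (xe u _) mm; apply: le_trans um' _.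
    by rewrite ler_nat.
  have /choice[lam_ lamP] (n : nat) : exists lam, is_time_change lam /\
      forall m : nat, (m <= n)%N ->
      (exists mu, skorokhod_close m%:R m.+1%:R^-1 mu x (x_ n)) ->
      skorokhod_close m%:R m.+1%:R^-1 lam x (x_ n).
    suff /(_ n) : forall b, exists lam, is_time_change lam /\
        forall m : nat, (m <= b)%N ->
        (exists mu, skorokhod_close m%:R m.+1%:R^-1 mu x (x_ n)) ->
        skorokhod_close m%:R m.+1%:R^-1 lam x (x_ n) by [].
    elim=> [|b [lam [tl IH]]].
      have [[mu xmu]|no] :=
          pselect (exists mu, skorokhod_close 0%:R 1%:R^-1 mu x (x_ n)).
        by exists mu; split=> [|m]; [case: xmu | rewrite leqn0 => /eqP ->].
      exists id; split; first exact: is_time_change_id.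
      by move=> m; rewrite leqn0 => /eqP -> /no.
    have [[mu xmu]|no] := pselect
        (exists mu, skorokhod_close b.+1%:R b.+2%:R^-1 mu x (x_ n)).
      exists mu; split=> [|m mb _]; first by case: xmu.
      exact: closeW xmu.
    exists lam; split=> // m; rewrite leq_eqVlt => /orP[/eqP -> /no //|mb].
    exact: IH.
  have ev (m : nat) : \forall n \near \oo,
      skorokhod_close m%:R m.+1%:R^-1 (lam_ n) x (x_ n).
    have xm : nbhs x [set y | exists lam,
        skorokhod_close m%:R m.+1%:R^-1 lam x y].
      by apply/nbhs_skorokhodP; exists m.
    have := xx _ xm; rewrite nbhs_simpl /= => {}xm.
    near=> n.
    apply: (lamP n).2; first by near: n; exact: nbhs_infty_ge.
    by near: n.
  have mP (k : nat) (e : R) : 0 < e ->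
      exists2 m : nat, (k <= m)%N & m.+1%:R^-1 <= e.
    move=> e0; exists (maxn k (Num.truncn e^-1)); first exact: leq_maxl.
    rewrite invf_ple ?posrE//; apply: le_trans (ltW (truncnS_gt _)) _.
    by rewrite ler_nat ltnS leq_maxr.
  exists lam_; split=> [n|e e0|k e e0]; first exact: (lamP n).1.
    have [m _ me] := mP 0%N e e0.
    by apply: filterS (ev m) => n [_ le _] u; exact: lt_le_trans (le u) me.
  have [m km me] := mP k e e0.
  apply: filterS (ev m) => n [_ _ xe] u uk; apply: lt_le_trans (xe u _) me.
  by apply: le_trans uk _; rewrite ler_nat.
move=> U /nbhs_skorokhodP[m mU]; rewrite /nbhs /=.
have m0 : 0 < m.+1%:R^-1 :> R by rewrite invr_gt0.
apply: filterS (filterI (lam_e _ m0) (xe m _ m0)) => n [ln xn].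
by apply: mU; exists (lam_ n); split.
Unshelve. all: by end_near. Qed.

Lemma skorokhod_hausdorff (R : realType) d : hausdorff_space (skorokhod R d).
Proof.
move=> x y xy.
have {xy}close (m : nat) : exists lam, skorokhod_close m%:R m.+1%:R^-1 lam x y.
  pose B m : set (skorokhod R d * skorokhod R d) :=
    [set p | exists lam, skorokhod_close m%:R m.+1%:R^-1 lam p.1 p.2].
  have eB : entourage (B m) by exists (m%:R, m.+1%:R^-1) => /=.
  have [C eC CB] := entourage_split_ex eB.
  have Cx : nbhs x (xsection C x) by exact: nbhs_entourage.
  have Cy : nbhs y (xsection (C^-1)%relation y).
    by apply: nbhs_entourage; exact: entourage_inv.
  have [z [/set_mem xz /set_mem zy]] := xy _ _ Cx Cy.
  by have := CB (x, y); apply; exists z.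
apply: cadlag_eq => u.
apply/eqP; rewrite -subr_eq0 -normr_eq0 eq_le normr_ge0 andbT.
apply/ler_addgt0Pl => e e0; rewrite addr0.
have e30 : 0 < e / 3 by rewrite divr_gt0.
have [/cvgrPdist_lt/(_ _ e30) + _] := cadlagP x u.
have [/cvgrPdist_lt/(_ _ e30) + _] := cadlagP y u.
rewrite !near_withinE => /nbhs_set_typeP[r r0 yr] /nbhs_set_typeP[s s0 xs].
pose q := Num.min r s.
have q0 : 0 < q by rewrite lt_min r0.
have qr : q <= r by rewrite ge_min lexx.
have qs : q <= s by rewrite ge_min lexx orbT.
have u0 := halfline_ge0 u.
have v0 : 0 <= set_val u + q / 2 by lra.
pose v := to_halfline v0.
have vE : set_val v = set_val u + q / 2 := to_halflineE v0.
pose e' := Num.min (q / 2) (e / 3).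
have e'0 : 0 < e' by rewrite lt_min e30 divr_gt0.
pose m := maxn (Num.truncn (set_val v)).+1 (Num.truncn e'^-1).
have [lam [_ lam_e xy_e]] := close m.
have vm : set_val v <= m%:R.
  by apply: le_trans (ltW (truncnS_gt _)) _; rewrite ler_nat leq_maxl.
have me : m.+1%:R^-1 <= e'.
  rewrite invf_ple ?posrE//; apply: le_trans (ltW (truncnS_gt _)) _.
  by rewrite ler_nat ltnS leq_maxr.
have h1 : `|x u - x v| < e / 3.
  apply: xs; rewrite /= vE; last lra.
  by rewrite ltr_norml; apply/andP; split; lra.
have h2 : `|y (lam v) - x v| < e / 3.
  apply: lt_le_trans (xy_e v vm) _; apply: le_trans me _.
  by rewrite ge_min lexx orbT.
have lv : `|set_val (lam v) - set_val v| < q / 2.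
  apply: lt_le_trans (lam_e v) _; apply: le_trans me _.
  by rewrite ge_min lexx.
have h3 : `|y u - y (lam v)| < e / 3.
  move: lv; rewrite ltr_norml vE => /andP[lv1 lv2].
  apply: yr; last by rewrite /=; lra.
  by rewrite ltr_norml; apply/andP; split; lra.
rewrite (_ : x u - y u =
  (x u - x v) - (y (lam v) - x v) - (y u - y (lam v))); last first.
  by rewrite !opprB; rewrite !subrKA.
apply: le_trans (ler_normB _ _) _.
have := ler_normB (x u - x v) (y (lam v) - x v); lra.
Qed.

(* alpha and alpha_inv are the mutually inverse homeomorphisms u / (t - u) and
   t v / (1 + v) between [0, t) and [0, oo). *)
Section alpha.
Context {R : realType} (t : {posnum R}).

Lemma alpha_subproof (u : cooint t%:num) :
  0 <= set_val u / (t%:num - set_val u).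
Proof.
by rewrite divr_ge0 ?cooint_ge0// subr_ge0 ltW// cooint_lt.
Qed.

Definition alpha (u : cooint t%:num) : halfline R :=
  to_halfline (alpha_subproof u).

Lemma alpha_inv_subproof0 (v : halfline R) :
  0 <= t%:num * set_val v / (1 + set_val v).
Proof.
by rewrite divr_ge0 ?mulr_ge0 ?halfline_ge0// addr_ge0// halfline_ge0.
Qed.

Lemma alpha_inv_subproof1 (v : halfline R) :
  t%:num * set_val v / (1 + set_val v) < t%:num.
Proof.
have v0 := halfline_ge0 v.
by rewrite ltr_pdivrMr ?ltr_pM2l//; lra.
Qed.

Definition alpha_inv (v : halfline R) : cooint t%:num :=
  to_cooint (alpha_inv_subproof0 v) (alpha_inv_subproof1 v).

Lemma alphaE u : set_val (alpha u) = set_val u / (t%:num - set_val u).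
Proof. by []. Qed.

Lemma alpha_invE v :
  set_val (alpha_inv v) = t%:num * set_val v / (1 + set_val v).
Proof. by []. Qed.

Lemma alphaK : cancel alpha alpha_inv.
Proof.
move=> u; apply: set_val_inj; rewrite alpha_invE alphaE.
have ut := cooint_lt u; have t0 : 0 < t%:num by [].
by field; rewrite !gt_eqF//; lra.
Qed.

Lemma alpha_invK : cancel alpha_inv alpha.
Proof.
move=> v; apply: set_val_inj; rewrite alphaE alpha_invE.
have v0 := halfline_ge0 v; have t0 : 0 < t%:num by [].
by field; rewrite !gt_eqF//; lra.
Qed.

Lemma alpha_continuous : continuous alpha.
Proof.
apply: continuous_set_type => u.
have cu := @val_continuous R (cooint t%:num) u.
have Fu : Filter (nbhs u) := nbhs_filter u.
apply: (cvgM cu); apply: cvgV; first by rewrite gt_eqF// subr_gt0 cooint_lt.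
exact: (cvgB (cvg_cst _) cu).
Qed.

Lemma alpha_inv_continuous : continuous alpha_inv.
Proof.
apply: continuous_set_type => v.
have cv := @val_continuous R (halfline R) v.
have Fv : Filter (nbhs v) := nbhs_filter v.
apply: (cvgM (cvgM (cvg_cst _) cv)).
apply: cvgV; first by rewrite gt_eqF// ltr_wpDr ?halfline_ge0.
exact: (cvgD (cvg_cst _) cv).
Qed.

Lemma alpha_inv_homo : {homo alpha_inv : u v / set_val u < set_val v}.
Proof.
move=> u v /= uv; have u0 := halfline_ge0 u; have v0 := halfline_ge0 v.
rewrite ltr_pdivrMr; last lra.
rewrite mulrAC ltr_pdivlMr; last lra.
rewrite -!mulrA ltr_pM2l//; lra.
Qed.

End alpha.

Definition uskorokhod (R : realType) (d : nat) (t : {posnum R}) : Type :=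
  cadlag d (cooint t%:num).
HB.instance Definition _ R d t := Choice.on (@uskorokhod R d t).

Definition unroll (R : realType) d (t : {posnum R}) (x : uskorokhod d t) :
    skorokhod R d :=
  Cadlag (is_cadlag_comp (@alpha_inv_continuous _ t) (@alpha_inv_homo _ t)
    (cadlagP x)).

Lemma unrollE (R : realType) d (t : {posnum R}) (x : uskorokhod d t) u :
  unroll x u = x (alpha_inv t u).
Proof. by []. Qed.

(* The topology transported from skorokhod R d by x |-> x \o alpha_inv. *)
HB.instance Definition _ R d t :=
  Uniform.copy (@uskorokhod R d t) (initial_topology (@unroll R d t)).

Lemma uskorokhod_cvgP (R : realType) d (t : {posnum R})
    (F : set_system (uskorokhod d t)) (x : uskorokhod d t) : Filter F ->
  F --> x <-> unroll y @[y --> F] --> unroll x.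
Proof.
move=> FF; split=> [Fx|Fx U].
  apply: cvg_comp Fx _.
  exact: (@initial_continuous (uskorokhod d t) _ (@unroll R d t) x).
case=> _ [[W oW <-] /= Wx] WU; apply: filterS WU _.
by apply: Fx; exact: open_nbhs_nbhs.
Qed.

Section projection.
Context {R : realType} (d : nat) (t : {posnum R}).

Definition cooint_incl (u : cooint t%:num) : halfline R :=
  to_halfline (cooint_ge0 u).

Lemma cooint_incl_continuous : continuous cooint_incl.
Proof. by apply: continuous_set_type => u; exact: val_continuous. Qed.

Definition skorokhod_proj (x : skorokhod R d) : uskorokhod d t :=
  Cadlag (is_cadlag_comp cooint_incl_continuous
    (fun u v uv => uv : set_val (cooint_incl u) < set_val (cooint_incl v))
    (cadlagP x)).

Lemma skorokhod_projE (x : skorokhod R d) u :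
  skorokhod_proj x u = x (cooint_incl u).
Proof. by []. Qed.

End projection.
Arguments skorokhod_proj {R} d t x.

(* Main.v *)
Require Import Defs.
From mathcomp Require Import all_boot all_order all_algebra.
From mathcomp Require Import all_classical all_reals all_analysis.
From mathcomp Require Import ring lra.
Import Order.TTheory GRing.Theory Num.Theory.
Local Open Scope classical_set_scope.
Local Open Scope ring_scope.

(* Closeness of y \o alpha_inv to x \o alpha_inv is only tested on a segment
   [0, k], which alpha_inv maps to [0, T] with T < t. If lam is a time change
   close enough to the identity, then lam T < t; conjugating lam by alpha on
   [0, k] and continuing it with slope 1 after k gives a time change mu, which
   is uniformly close to the identity because alpha is Lipschitz on [0, T']
   for every T' < t. *)

(** A strictly increasing map is injective, so a right inverse is an inverse, and surjectivity rules
    out jumps. Continuity of a map glued from two pieces thus needs no check at the junction. *)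
Lemma incr_surj_time_change (R : realType) (lam : halfline R -> halfline R) :
  {homo lam : u v / set_val u < set_val v} ->
  (forall w, exists v, lam v = w) -> is_time_change lam.
Proof.
move=> ml /choice[mu muK].
have lam_inj : injective lam.
  move=> u v uv; apply: set_val_inj.
  by case: (ltgtP (set_val u) (set_val v)) => // /ml; rewrite uv ltxx.
split => //; first exact: incr_can_continuous ml muK.
by exists mu => // u; apply: lam_inj; rewrite muK.
Qed.

Lemma time_change_homo_le (R : realType) (lam : halfline R -> halfline R) :
  is_time_change lam -> {homo lam : u v / set_val u <= set_val v}.
Proof.
move=> [_ ml _] u v; rewrite le_eqVlt => /orP[/eqP/set_val_inj -> //|/ml].
exact: ltW.
Qed.

(** The difference equals $t(u-v)/((t-u)(t-v))$ exactly, and both factors of the denominator are at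
    least [c]. *)
Lemma alpha_dist (R : realType) (t : {posnum R}) (u v : cooint t%:num) (c : R) :
  0 < c -> c <= t%:num - set_val u -> c <= t%:num - set_val v ->
  `|set_val (alpha u) - set_val (alpha v)| <=
    t%:num / c ^+ 2 * `|set_val u - set_val v|.
Proof.
move=> c0 cu cv; rewrite !alphaE.
have t0 : 0 < t%:num by [].
have u0 : 0 < t%:num - set_val u by lra.
have v0 : 0 < t%:num - set_val v by lra.
rewrite (_ : _ - _ = t%:num / ((t%:num - set_val u) * (t%:num - set_val v)) *
    (set_val u - set_val v)); last by field; rewrite !gt_eqF.
rewrite normrM ler_wpM2r// ger0_norm; last by rewrite divr_ge0// mulr_ge0// ltW.
rewrite ler_pM2l// lef_pV2 ?posrE ?mulr_gt0 ?exprn_gt0//.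
by rewrite expr2 ler_pM// ltW.
Qed.

(** By monotonicity, the bound at the image of [k] keeps [lam] below [t] on the whole image of
    $[0,k]$, so that [alpha] can be applied to its values there. *)
Lemma time_change_conj_alpha (R : realType) (t : {posnum R})
    (lam : halfline R -> halfline R) (k : halfline R) :
  is_time_change lam ->
  set_val (lam (cooint_incl (alpha_inv t k))) < t%:num ->
  exists mu, [/\ is_time_change mu,
    forall v, set_val v <= set_val k ->
      cooint_incl (alpha_inv t (mu v)) = lam (cooint_incl (alpha_inv t v)) &
    forall v, set_val k <= set_val v ->
      set_val (mu v) - set_val v = set_val (mu k) - set_val k].
Proof.
move=> tl lamT; have [_ ml [nu lamK nuK]] := tl.
pose emb v : halfline R := cooint_incl (alpha_inv t v).
have emb_lt u v : set_val u < set_val v -> set_val (emb u) < set_val (emb v).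
  by move=> /(@alpha_inv_homo R t).
have emb_mono u v :
    set_val u <= set_val v -> set_val (emb u) <= set_val (emb v).
  by rewrite le_eqVlt => /orP[/eqP/set_val_inj -> //|/emb_lt/ltW].
have emb_inj : injective emb.
  move=> u v uv; apply: (can_inj (@alpha_invK R t)); apply: set_val_inj.
  by have /(congr1 set_val) := uv.
have emb_alpha (r : halfline R) : set_val r < t%:num ->
    exists v, emb v = r.
  move=> rt; pose s := to_cooint (halfline_ge0 r) rt.
  exists (alpha s); apply: set_val_inj.
  exact: (congr1 set_val (@alphaK R t s)).
have emb_le u v : set_val (emb u) <= set_val (emb v) -> set_val u <= set_val v.
  by rewrite leNgt => uv; rewrite leNgt; apply: contra uv; exact: emb_lt.
have [w wE] := emb_alpha _ lamT.
have tail (v : halfline R) : set_val k <= set_val v ->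
    0 <= set_val w + (set_val v - set_val k).
  by move=> kv; rewrite addr_ge0 ?halfline_ge0 ?subr_ge0.
(* The two clauses overlap at [v = k], where both force the value [w]. *)
have /choice[mu muP] (v : halfline R) : exists s,
    (set_val v <= set_val k -> emb s = lam (emb v)) /\
    (set_val k <= set_val v -> set_val s = set_val w + (set_val v - set_val k)).
  have [vk|kv] := leP (set_val v) (set_val k); last first.
    by exists (to_halfline (tail v (ltW kv))).
  have [|s sE] := emb_alpha (lam (emb v)).
    apply: le_lt_trans lamT; apply: (time_change_homo_le _ _ tl).
    exact: emb_mono.
  exists s; split=> // kv.
  have vkE : v = k by apply: set_val_inj; apply/eqP; rewrite eq_le vk.
  subst v; have -> : s = w by apply: emb_inj; rewrite sE wE.
  by rewrite subrr addr0.
have muk : mu k = w by apply: emb_inj; rewrite (muP k).1.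
have mu_le v : set_val v <= set_val k -> set_val (mu v) <= set_val w.
  move=> vk; apply: emb_le; rewrite (muP v).1// wE.
  by apply: (time_change_homo_le _ _ tl); exact: emb_mono.
exists mu; split => [|v /(muP v).1 //|v kv]; last first.
  by rewrite muk (muP v).2//; lra.
apply: incr_surj_time_change => [u v uv|s].
  have [vk|kv] := leP (set_val v) (set_val k).
    rewrite ltNge; apply/negP => h.
    have := ml _ _ (emb_lt _ _ uv).
    rewrite -(muP v).1// -(muP u).1 ?(le_trans (ltW uv))//.
    move: h; rewrite le_eqVlt => /orP[/eqP/set_val_inj ->|/emb_lt h].
      by rewrite ltxx.
    by move=> /(lt_trans h); rewrite ltxx.
  rewrite (muP v).2; last exact: ltW.
  have [uk|ku] := leP (set_val u) (set_val k).
    by have := mu_le u uk; lra.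
  by rewrite (muP u).2 ?(ltW ku)//; lra.
(* Surjectivity: above [w] the translation is inverted; below [w] the preimage of [emb s] under
   [lam] stays below [emb k], hence in the range of [emb]. *)
have [sw|ws] := leP (set_val s) (set_val w); last first.
  have v0 : 0 <= set_val k + (set_val s - set_val w).
    by rewrite addr_ge0 ?halfline_ge0// subr_ge0 ltW.
  exists (to_halfline v0); apply: set_val_inj.
  by rewrite (muP _).2 to_halflineE; lra.
have nus : set_val (nu (emb s)) <= set_val (emb k).
  rewrite leNgt; apply/negP => /ml; rewrite nuK -wE ltNge => /negP; apply.
  exact: emb_mono.
have [|v vE] := emb_alpha (nu (emb s)).
  by apply: le_lt_trans nus _; exact: cooint_lt.
exists v; apply: emb_inj; rewrite (muP v).1 ?vE ?nuK//.
by apply: emb_le; rewrite vE.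
Qed.

(** The radius [r] is uniform in [lam], [x] and [y]. Horizon [t] suffices because [alpha_inv] takes
    its values in $[0,t)$. *)
Lemma skorokhod_close_proj (R : realType) (d : nat) (t : {posnum R})
    (k : halfline R) (e : R) : 0 < e ->
  exists2 r : R, 0 < r & forall lam (x y : skorokhod R d),
    skorokhod_close t%:num r lam x y ->
    exists mu, skorokhod_close (set_val k) e mu
      (unroll (skorokhod_proj d t x)) (unroll (skorokhod_proj d t y)).
Proof.
move=> e0.
set T := set_val (alpha_inv t k).
have t0 : 0 < t%:num by [].
(* Half the gap: a point of $[0,T]$ moved by less than [c] is still at distance more than [c] from
   [t]. *)
pose c := (t%:num - T) / 2.
have Tt : T < t%:num by exact: cooint_lt.
have c0 : 0 < c by rewrite divr_gt0// subr_gt0.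
have L0 : 0 < t%:num / c ^+ 2 by rewrite divr_gt0// exprn_gt0.
have cT : T + c = t%:num - c by rewrite /c; lra.
clearbody c.
(* The bounds serve, in order, to stay away from [t], to compare the values of the paths, and to
   absorb the Lipschitz constant of [alpha]. *)
exists (Num.min c (Num.min e (e / (t%:num / c ^+ 2)))).
  by rewrite !lt_min c0 e0 divr_gt0.
move=> lam x y [tl lam_r xy_r].
have lam_c u : `|set_val (lam u) - set_val u| < c.
  by have := lam_r u; rewrite lt_min => /andP[].
have lamT : set_val (lam (cooint_incl (alpha_inv t k))) < t%:num.
  have := lam_c (cooint_incl (alpha_inv t k)); rewrite to_halflineE -/T.
  by rewrite ltr_norml; lra.
have [mu [tm muE mu_tail]] := @time_change_conj_alpha R t lam k tl lamT.
have mu_e v : set_val v <= set_val k -> `|set_val (mu v) - set_val v| < e.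
  move=> vk.
  have vT : set_val (alpha_inv t v) <= T.
    move: vk; rewrite le_eqVlt => /orP[/eqP/set_val_inj -> //|].
    by move=> /(@alpha_inv_homo R t)/ltW.
  have := congr1 set_val (muE v vk); rewrite to_halflineE => muE'.
  have := lam_c (cooint_incl (alpha_inv t v)).
  rewrite -muE' to_halflineE => dc.
  have := lam_r (cooint_incl (alpha_inv t v)).
  rewrite !lt_min -muE' to_halflineE => /and3P[_ _ dr].
  rewrite -[mu v](@alpha_invK R t) -[v in X in _ - X](@alpha_invK R t).
  apply: le_lt_trans (@alpha_dist R t _ _ c c0 _ _) _.
  - by move: dc; rewrite ltr_norml; lra.
  - lra.
  - by rewrite mulrC -ltr_pdivlMr.
exists mu; split=> // [v|v vk].
  (* Beyond [k] the displacement of [mu] is the one at [k]. *)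
  have [|kv] := leP (set_val v) (set_val k); first exact: mu_e.
  by rewrite mu_tail ?(ltW kv)//; exact: mu_e.
rewrite !unrollE !skorokhod_projE muE//.
apply: lt_le_trans (xy_r _ _) _; first exact: ltW (cooint_lt _).
by rewrite !ge_min lexx !orbT.
Qed.

Theorem proposition2 (R : realType) (d : nat) (t : {posnum R}) :
  continuous (skorokhod_proj d t : skorokhod R d -> uskorokhod d t).
Proof.
(* The target carries the initial topology of [unroll], so convergence is tested after unrolling. *)
move=> x; apply/uskorokhod_cvgP.
  exact: fmap_filter (nbhs_filter x).
move=> U /nbhs_skorokhodP[m mU].
have e0 : 0 < m.+1%:R^-1 :> R by rewrite invr_gt0.
have [r r0 rP] :=
  @skorokhod_close_proj R d t (to_halfline (ler0n R m)) _ e0.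
pose B : set (skorokhod R d * skorokhod R d) :=
  [set p | exists lam, skorokhod_close t%:num r lam p.1 p.2].
have eB : entourage B by exists (t%:num, r).
apply: filterS (nbhs_entourage x eB) => y /set_mem[lam xy].
by apply: mU; exact: rP xy.
Qed.
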